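(* Let $G_N,G$ be proposal fields on the position space with values in $\mathbb R^d$, with each $G_N$ measurable and $G_N\to G$ locally uniformly as $N\to\infty$, let $v:\mathbb R^d\to\mathbb R^d$, and assume $G$ and $v$ are continuous. Fix $h>0$ and $L\in\mathbb N$. Suppose also that the potentials $U_N$ (measurable, with values in $(-\infty,\infty]$) converge locally uniformly to a real-valued function $U$ on the position space, and that $U$ and the kinetic energy $K:\mathbb R^d\to\mathbb R$ are continuous. Let $\alpha_N,M_N$ be the acceptance function and deterministic Metropolis kernel built from $\mathcal H_N=U_N+K$ and $\Psi_N$, and let $\alpha,M$ be those built from $\mathcal H(x,p)=U(x)+K(p)$ and $\Psi$ (all defined in the context). Then on every admissible compact set $C$, $$\sup_{z\in C}|\alpha_N(z)-\alpha(z)|\longrightarrow0\qquad(N\to\infty).$$ For every bounded Lipschitz function $f$ on the phase space, $$\sup_{z\in C}|M_Nf(z)-Mf(z)|\longrightarrow0 .$$ Moreover, $$\sup_{z\in C}d_{\mathrm{BL}}\bigl(M_N(z,\cdot),M(z,\cdot)\bigr)\longrightarrow0,$$ where $d_{\mathrm{BL}}(\nu_1,\nu_2)=\sup_{\|f\|_\infty+\mathrm{Lip}(f)\le1}\left|\int f\,d\nu_1-\int f\,d\nu_2\right|$.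
   Context: The position space is $\mathbb R^d$, or the positive orthant $(0,\infty)^d$ if the position variable is restricted to it; the phase space is position space times momentum space $\mathbb R^d$, with points $z=(x,p)$ and the Euclidean metric. Locally uniform convergence means uniform convergence on compact subsets of the position space. Define $$\mathcal P_{N,h}(x,p)=(x,p-hG_N(x)),\quad\mathcal P_h(x,p)=(x,p-hG(x)),\quad\mathcal Q_h(x,p)=(x+hv(p),p),\quad\mathcal R(x,p)=(x,-p),$$ $$\Phi_{N,h}=\mathcal P_{N,h/2}\circ\mathcal Q_h\circ\mathcal P_{N,h/2},\quad\Phi_h=\mathcal P_{h/2}\circ\mathcal Q_h\circ\mathcal P_{h/2},\quad\Psi_N=\mathcal R\circ\Phi_{N,h}^L,\quad\Psi=\mathcal R\circ\Phi_h^L,$$ where the superscript denotes iterated composition. With $\mathcal H_N(x,p)=U_N(x)+K(p)$ and $w_N=\exp(-\mathcal H_N)$ (with $\exp(-\infty)=0$), put $\alpha_N(z)=\min\{1,w_N(\Psi_Nz)/w_N(z)\}$ if $w_N(z)>0$ and $\alpha_N(z)=1$ if $w_N(z)=0$, and $$M_N(z,dz')=\alpha_N(z)\delta_{\Psi_Nz}(dz')+[1-\alpha_N(z)]\delta_z(dz').$$ Likewise $\alpha(z)=\min\{1,\exp[-\mathcal H(\Psi z)+\mathcal H(z)]\}$ and $M(z,dz')=\alpha(z)\delta_{\Psi z}(dz')+[1-\alpha(z)]\delta_z(dz')$. For a kernel $M$, $Mf(z)=\int f(z')M(z,dz')$. Admissible compact set: for fixed $h>0$ and $L\in\mathbb N$,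 a compact subset $C$ of the phase space is admissible (for $\{\Phi_{N,h}\}_{N\ge0}$ and $\Phi_h$) if there exist a compact set $C_\ast$ in $\mathbb R^d\times\mathbb R^d$ and an integer $N_0$ such that for every $N\ge N_0$ and every $\ell=0,\dots,L-1$, $$\Phi_{N,h}^\ell(C)\subset C_\ast,\quad\mathcal P_{N,h/2}(\Phi_{N,h}^\ell(C))\subset C_\ast,\quad\mathcal Q_h\circ\mathcal P_{N,h/2}(\Phi_{N,h}^\ell(C))\subset C_\ast,$$ $$\Phi_h^\ell(C)\subset C_\ast,\quad\mathcal P_{h/2}(\Phi_h^\ell(C))\subset C_\ast,\quad\mathcal Q_h\circ\mathcal P_{h/2}(\Phi_h^\ell(C))\subset C_\ast,$$ and moreover $\Phi_{N,h}^L(C)\cup\Phi_h^L(C)\subset C_\ast$ for all $N\ge N_0$, and $\mathcal R(C_\ast)=C_\ast$. If the position variable is restricted to the positive orthant, it is additionally required that the position projection of $C_\ast$ be compactly contained in that orthant. (In that case the trajectories from $C$ are well defined for $N\ge N_0$ and for the limiting maps by these containments.) *)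

(* Defs.v *)
From HB Require Import structures.
From mathcomp Require Import all_boot all_order all_algebra.
From mathcomp Require Import all_classical all_reals all_analysis.
From mathcomp Require Import measurable_realfun.
Set Implicit Arguments.
Unset Strict Implicit.
Unset Printing Implicit Defensive.
Import Order.TTheory GRing.Theory Num.Theory.
Import numFieldNormedType.Exports.
Local Open Scope classical_set_scope.
Local Open Scope ring_scope.

Notation borel T := (g_sigma_algebraType (@open T)).

Notation position R d := 'rV[R]_d.
Notation phasePoint R d := ('rV[R]_d * 'rV[R]_d)%type.

(* Supremum in [0, +oo] of a nonnegative function; unlike ereal_sup, it is 0
   (and not -oo) over the empty set. *)
Definition nnsup (R : realType) (T : Type) (A : set T) (F : T -> \bar R) :
    \bar R :=
  ereal_sup (0%E |` [set F t | t in A]).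

Section Spaces.
Variables (R : realType) (d : nat).

Definition orthant : set (position R d) := [set x | forall i, 0 < x ord0 i].

(* Fields, potentials and test functions are total functions of which only the
   values over the position space X are ever constrained or used; X is either
   the whole space or the positive orthant. *)
Definition position_space (X : set (position R d)) : Prop :=
  X = setT \/ X = orthant.

Definition phase (X : set (position R d)) : set (phasePoint R d) :=
  [set z | X z.1].

(* The library norm on 'rV is the max-norm; Lipschitz constants below refer to
   the Euclidean distance. *)
Definition edist (z w : phasePoint R d) : R :=
  Num.sqrt (\sum_(i < d) (z.1 ord0 i - w.1 ord0 i) ^+ 2
            + \sum_(i < d) (z.2 ord0 i - w.2 ord0 i) ^+ 2).

Definition measurable_field (X : set (position R d))
    (G : position R d -> 'rV[R]_d) : Prop :=
  measurable_fun (X : set (borel (position R d)))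
    (G : borel (position R d) -> borel 'rV[R]_d).

Definition measurable_potential (X : set (position R d))
    (U : position R d -> \bar R) : Prop :=
  measurable_fun (X : set (borel (position R d)))
    (U : borel (position R d) -> \bar R).

Definition locally_uniform_cvg (X : set (position R d))
    (G_ : nat -> position R d -> 'rV[R]_d) (G : position R d -> 'rV[R]_d) :=
  forall A : set (position R d), compact A -> A `<=` X ->
    {uniform A, G_ @ \oo --> G}.

(* The distance |U_N - U| is taken in [0, +oo]: it is infinite where U_N = +oo.
   (The library metric on \bar R is bounded, hence not used here.) *)
Definition locally_uniform_ecvg (X : set (position R d))
    (U_ : nat -> position R d -> \bar R) (U : position R d -> R) :=
  forall A : set (position R d), compact A -> A `<=` X ->
    (fun N => nnsup A (fun x => `|U_ N x - (U x)%:E|%E)) @ \oo --> 0%E.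

End Spaces.

Section Dynamics.
Variables (R : realType) (d : nat).
Implicit Types (G v : 'rV[R]_d -> 'rV[R]_d) (h : R) (z : phasePoint R d).

Definition kick G h z : phasePoint R d := (z.1, z.2 - h *: G z.1).
Definition drift v h z : phasePoint R d := (z.1 + h *: v z.2, z.2).
Definition momentum_flip z : phasePoint R d := (z.1, - z.2).

Definition leapfrog G v h : phasePoint R d -> phasePoint R d :=
  kick G (h / 2) \o drift v h \o kick G (h / 2).

Definition proposal G v h (L : nat) : phasePoint R d -> phasePoint R d :=
  momentum_flip \o iter L (leapfrog G v h).

Definition compactly_contained (A X : set (position R d)) : Prop :=
  compact (closure A) /\ closure A `<=` X.

(* The images of C under the first l leapfrog steps and under the kick and the
   drift of the next step, for l < L, and under all L steps. *)
Definition trajectory_in G v h (L : nat) (C Cs : set (phasePoint R d)) : Prop :=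
  (forall l : nat, (l < L)%N ->
    [/\ iter l (leapfrog G v h) @` C `<=` Cs,
        kick G (h / 2) @` (iter l (leapfrog G v h) @` C) `<=` Cs &
        (drift v h \o kick G (h / 2)) @` (iter l (leapfrog G v h) @` C)
          `<=` Cs]) /\
  iter L (leapfrog G v h) @` C `<=` Cs.

(* Compact containment of the projection of Cs in X is automatic when X = setT,
   as Cs is compact; in the orthant case it ensures that the fields are only
   evaluated inside X along the trajectories issued from C. *)
Definition admissible (X : set (position R d)) (G_ : nat -> 'rV[R]_d -> 'rV[R]_d)
    G v h (L : nat) (C : set (phasePoint R d)) : Prop :=
  [/\ compact C, C `<=` phase X &
    exists (Cs : set (phasePoint R d)) (N0 : nat),
    [/\ compact Cs,
        forall N : nat, (N0 <= N)%N ->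
          trajectory_in (G_ N) v h L C Cs /\ trajectory_in G v h L C Cs,
        momentum_flip @` Cs = Cs &
        compactly_contained (fst @` Cs) X]].

End Dynamics.

Section Metropolis.
Variables (R : realType) (d : nat).
Implicit Types (K : 'rV[R]_d -> R) (Psi : phasePoint R d -> phasePoint R d).

Definition ehamiltonian (U : position R d -> \bar R) K (z : phasePoint R d) :
    \bar R :=
  (U z.1 + (K z.2)%:E)%E.

(* expeR -oo = 0, and the value is finite as soon as U does not take -oo. *)
Definition weight (U : position R d -> \bar R) K (z : phasePoint R d) : R :=
  fine (expeR (- ehamiltonian U K z)%E).

Definition eaccept (U : position R d -> \bar R) K Psi (z : phasePoint R d) : R :=
  if 0 < weight U K z then Num.min 1 (weight U K (Psi z) / weight U K z) else 1.

Definition hamiltonian (U : position R d -> R) K (z : phasePoint R d) : R :=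
  U z.1 + K z.2.

Definition accept (U : position R d -> R) K Psi (z : phasePoint R d) : R :=
  Num.min 1 (expR (- hamiltonian U K (Psi z) + hamiltonian U K z)).

Lemma weight_ge0 U K z : 0 <= weight U K z.
Proof. exact/fine_ge0/expeR_ge0. Qed.

Lemma eaccept01 U K Psi z : 0 <= eaccept U K Psi z <= 1.
Proof.
rewrite /eaccept; case: ifPn => _; last by rewrite ler01 lexx.
by rewrite le_min ler01 divr_ge0 ?weight_ge0// ge_min lexx.
Qed.

Lemma accept01 U K Psi z : 0 <= accept U K Psi z <= 1.
Proof. by rewrite /accept le_min ler01 expR_ge0 ge_min lexx. Qed.

Let accept_prob_ge0 (a : R) (a01 : 0 <= a <= 1) : 0 <= a.
Proof. by case/andP: a01. Qed.

Let reject_prob_ge0 (a : R) (a01 : 0 <= a <= 1) : 0 <= 1 - a.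
Proof. by case/andP: a01; rewrite subr_ge0. Qed.

Definition metropolis (alpha : phasePoint R d -> R)
    (alpha01 : forall z, 0 <= alpha z <= 1) Psi (z : phasePoint R d) :
    {measure set (borel (phasePoint R d)) -> \bar R} :=
  measure_add
    (mscale (NngNum (accept_prob_ge0 (alpha01 z)))
       (dirac (Psi z : borel (phasePoint R d))))
    (mscale (NngNum (reject_prob_ge0 (alpha01 z)))
       (dirac (z : borel (phasePoint R d)))).

Definition emetropolis_kernel (U : position R d -> \bar R) K Psi :=
  metropolis (eaccept01 U K Psi) Psi.

Definition metropolis_kernel (U : position R d -> R) K Psi :=
  metropolis (accept01 U K Psi) Psi.

End Metropolis.

Section BoundedLipschitz.
Variables (R : realType) (d : nat) (X : set (position R d)).
Implicit Types (f : phasePoint R d -> R).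

Definition supnorm f : \bar R := nnsup (phase X) (fun z => `|f z|%:E).

(* Pairs on the diagonal contribute 0, by the convention x / 0 = 0. *)
Definition lip f : \bar R :=
  nnsup (phase X `*` phase X)
    (fun zw => (`|f zw.1 - f zw.2| / edist zw.1 zw.2)%:E).

Definition phase_int (nu : {measure set (borel (phasePoint R d)) -> \bar R}) f :
    \bar R :=
  (\int[nu]_(z in phase X) (f z)%:E)%E.

Definition dBL (nu1 nu2 : {measure set (borel (phasePoint R d)) -> \bar R}) :
    \bar R :=
  ereal_sup [set `|phase_int nu1 f - phase_int nu2 f|%E
            | f in [set f | (supnorm f + lip f <= 1)%E]].

End BoundedLipschitz.

(* Main.v *)
Require Import Defs.
From HB Require Import structures.
From mathcomp Require Import all_boot all_order all_algebra.
From mathcomp Require Import all_classical all_reals all_analysis.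
From mathcomp Require Import measurable_realfun.
From mathcomp Require Import ring lra.
Set Implicit Arguments.
Unset Strict Implicit.
Unset Printing Implicit Defensive.
Import Order.TTheory GRing.Theory Num.Theory.
Import numFieldNormedType.Exports.
Local Open Scope classical_set_scope.
Local Open Scope ring_scope.

(** On an admissible compact set all the intermediate positions and momenta of
    the approximate and of the limiting trajectories lie in one compact set
    [Cs]. Kicks, drifts and the momentum flip are continuous on [Cs], and the
    approximate kicks converge uniformly there, because the fields do so on the
    projection of [Cs]. Uniform convergence is preserved by composition when the
    outer limit map is continuous on a compact set that contains all the
    intermediate values ([uniform_cvg_comp]); hence the proposals converge
    uniformly ([uniform_cvg_proposal]).

    On the projection of [Cs] the potentials are eventually finite
    ([locally_uniform_ecvg_fine]). The acceptance probability is then the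
    1-Lipschitz function min(1, exp t) of the energy difference t
    ([eaccept_fine], [accept_lipschitz]), and the energies along the proposals
    converge uniformly, by one more composition.

    Finally, the integral of a bounded Lipschitz function against the kernel is
    the two-point average a f(Psi z) + (1 - a) f(z). Its variation is bounded by
    the variations of a and of Psi z, with constants that depend only on the two
    seminorms of f ([phase_int_metropolis_dist]). The convergence is thus
    uniform over the unit ball that defines the bounded-Lipschitz distance. *)

(** * Uniform convergence on compact sets *)

Section UniformConvergence.
Context {R : realType}.

Lemma uniform_cvgP (T : choiceType) (V : pseudoMetricType R) (A : set T)
    (f_ : nat -> T -> V) (f : T -> V) :
  {uniform A, f_ @ \oo --> f} <->
  forall e : R, 0 < e ->
    \forall N \near \oo, forall x, A x -> ball (f x) e (f_ N x).
Proof.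
split=> [cf e e0|cf P /uniform_nbhs[E [+ EP]]].
  have := cf [set g | forall x, A x -> ball (f x) e (g x)]; apply.
  apply/uniform_nbhs; exists [set xy | ball xy.1 e xy.2]; split => //.
  exact: (entourage_ball _ (PosNum e0)).
rewrite -entourage_ballE => -[e /= e0 eE].
apply: filterS (cf e e0) => N Nf; apply: EP => x Ax.
by apply: eE => /=; exact: Nf.
Qed.

(** Heine-Cantor: a radius that works at a point of the compact set also works,
    after halving, at all nearby points, so finitely many radii suffice. *)
Lemma compact_within_unif_continuous (S V : pseudoMetricType R)
    (A : set S) (g : S -> V) :
  compact A -> {within A, continuous g} -> forall e : R, 0 < e ->
  exists2 r : R, 0 < r & forall x y, A x -> A y -> ball x r y ->
    ball (g x) e (g y).
Proof.
move=> /compact_near_coveringP cA /subspace_continuousP cg e e0.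
have e20 : 0 < e / 2 by rewrite divr_gt0.
have /filter_ex[r [/= r0 Pr]] : \forall r \near 0^'+, 0 < r /\
    A `<=` (fun x => forall y, A x -> A y -> ball x r y -> ball (g x) e (g y)).
  near=> r; split; first by near: r; exact: nbhs_right_gt.
  near: r.
  apply: (cA R 0^'+
    (fun r x => forall y, A x -> A y -> ball x r y -> _)) => x Ax.
  have /nbhs_ballP[s /= s0 gs] := cg x Ax _ (nbhsx_ballx _ _ e20).
  have s20 : 0 < s / 2 by rewrite divr_gt0.
  exists (ball x (s / 2), [set r | r <= s / 2]) => /=.
    by split; [exact: nbhsx_ballx | exact: nbhs_right_ltW].
  move=> [x' r] [/= xx' rs] y Ax' Ay x'y.
  apply: (@ball_splitr _ _ (g x)).
    by apply: gs => //; apply: le_ball xx'; lra.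
  by apply: gs => //; apply: (@ball_split _ _ x') => //; exact: le_ball x'y.
by exists r => // x y Ax Ay; exact: Pr.
Unshelve. all: by end_near. Qed.

(** Replacing first the outer map by its limit and then the inner one, the
    error is controlled by uniform convergence on [B] and by the modulus of
    continuity of the limit on [B]; both require the inner values to lie in [B]. *)
Lemma uniform_cvg_comp (T S : pseudoMetricType R) (V : pseudoMetricType R)
    (A : set T) (B : set S) (f_ : nat -> T -> S) (f : T -> S)
    (g_ : nat -> S -> V) (g : S -> V) :
  compact B -> {within B, continuous g} ->
  (\forall N \near \oo, f_ N @` A `<=` B) -> f @` A `<=` B ->
  {uniform A, f_ @ \oo --> f} -> {uniform B, g_ @ \oo --> g} ->
  {uniform A, (fun N => g_ N \o f_ N) @ \oo --> g \o f}.
Proof.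
move=> cB cg f_AB fAB /uniform_cvgP cf /uniform_cvgP cg_.
apply/uniform_cvgP => e e0.
have e20 : 0 < e / 2 by rewrite divr_gt0.
have [r r0 gr] := compact_within_unif_continuous cB cg e20.
near=> N => x Ax /=.
have Bfx : B (f x) by apply: fAB; exists x.
have Bfx_ : B (f_ N x) by apply: (near f_AB N) => //; exists x.
apply: (@ball_split _ _ (g (f_ N x))).
  apply: gr => //; move: x Ax {Bfx Bfx_}; near: N; exact: cf.
by move: (f_ N x) Bfx_; near: N; exact: cg_.
Unshelve. all: by end_near. Qed.

Lemma uniform_cvg_cst (T : choiceType) (V : pseudoMetricType R) (A : set T)
    (f : T -> V) : {uniform A, (fun _ : nat => f) @ \oo --> f}.
Proof. by apply/uniform_cvgP => e e0; near=> N => x _; exact: ballxx.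
Unshelve. all: by end_near. Qed.

Lemma within_continuous_fst (S1 S2 V : topologicalType) (A : set (S1 * S2))
    (g : S1 -> V) :
  {within fst @` A, continuous g} -> {within A, continuous (g \o fst)}.
Proof.
move=> /subspace_continuousP cg; apply/subspace_continuousP => z Az P gP.
have gz : \forall x \near nbhs z.1, (fst @` A) x -> P (g x).
  by apply: cg => //; exists z.
have : \forall w \near nbhs z, (fst @` A) w.1 -> P (g w.1) by exact: cvg_fst gz.
by apply: filterS => w gw Aw; apply: gw; exists w.
Qed.

End UniformConvergence.

(** * Suprema that may be infinite *)

Section NonnegativeSup.
Context {R : realType} {T : Type}.
Implicit Types (A : set T) (F : T -> \bar R).

Lemma nnsup_ge0 A F : (0 <= nnsup A F)%E.
Proof. by apply: ereal_sup_ubound; left. Qed.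

Lemma nnsup_ub A F t : A t -> (F t <= nnsup A F)%E.
Proof. by move=> At; apply: ereal_sup_ubound; right; exists t. Qed.

Lemma nnsup_le A F (b : \bar R) :
  (0 <= b)%E -> (forall t, A t -> (F t <= b)%E) -> (nnsup A F <= b)%E.
Proof.
by move=> b0 Fb; apply: ge_ereal_sup => _ [->//|[t /= At <-]]; exact: Fb.
Qed.

Lemma nnsup_cvg0P A (F_ : nat -> T -> \bar R) :
  (fun N => nnsup A (F_ N)) @ \oo --> 0%E <->
  forall e : R, 0 < e ->
    \forall N \near \oo, forall t, A t -> (F_ N t <= e%:E)%E.
Proof.
split=> [/fine_cvgP[fF /cvgrPdist_le cF] e e0|cF].
  near=> N => t At; apply: (le_trans (nnsup_ub _ At)).
  rewrite -[leLHS]fineK; last by near: N.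
  have : `|0 - fine (nnsup A (F_ N))| <= e by near: N; exact: cF.
  by rewrite lee_fin sub0r normrN => /(le_trans (ler_norm _)).
have leF e : 0 < e -> \forall N \near \oo, (nnsup A (F_ N) <= e%:E)%E.
  move=> e0; apply: filterS (cF e e0) => N FN.
  by apply: nnsup_le => //; rewrite lee_fin ltW.
have finF : \forall N \near \oo, nnsup A (F_ N) \is a fin_num.
  apply: filterS (leF 1 ltr01) => N FN; rewrite ge0_fin_numE ?nnsup_ge0//.
  exact: le_lt_trans FN (ltry _).
apply/fine_cvgP; split=> //; apply/cvgrPdist_le => e e0; near=> N.
rewrite sub0r normrN ger0_norm ?fine_ge0 ?nnsup_ge0//=.
rewrite -lee_fin fineK; last by near: N.
by near: N; exact: leF.
Unshelve. all: by end_near. Qed.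

End NonnegativeSup.

(** * Convergence of the proposal maps *)

Section ProposalConvergence.
Context {R : realType} {d : nat}.
Implicit Types (A Cs : set (phasePoint R d)) (G v : 'rV[R]_d -> 'rV[R]_d).

Lemma cvg_within_fst (S1 S2 : topologicalType) (A : set (S1 * S2))
    (z : S1 * S2) :
  w.1 @[w --> within A (nbhs z)] --> z.1.
Proof. by apply: cvg_within_filter => P; exact: cvg_fst. Qed.

Lemma cvg_within_snd (S1 S2 : topologicalType) (A : set (S1 * S2))
    (z : S1 * S2) :
  w.2 @[w --> within A (nbhs z)] --> z.2.
Proof. by apply: cvg_within_filter => P; exact: cvg_snd. Qed.

Lemma within_continuous_kick G (h : R) Cs :
  {within fst @` Cs, continuous G} -> {within Cs, continuous (kick G h)}.
Proof.
move=> /within_continuous_fst/subspace_continuousP cG.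
apply/subspace_continuousP => z Cz.
apply: (@cvg_pair _ _ _ _ (nbhs z.1) (nbhs (kick G h z).2) _ _ _
  fst (fun w => w.2 - h *: G w.1)); first exact: cvg_within_fst.
apply: cvgB; first exact: cvg_within_snd.
by apply: cvgZl_tmp; exact: cG.
Qed.

Lemma continuous_drift v (h : R) : continuous v -> continuous (drift v h).
Proof.
move=> cv z.
apply: (@cvg_pair _ _ _ _ (nbhs (drift v h z).1) (nbhs z.2) _ _ _
  (fun w => w.1 + h *: v w.2) snd); last by move=> P; exact: cvg_snd.
apply: cvgD; first by move=> P; exact: cvg_fst.
apply: cvgZl_tmp; apply: (@cvg_comp _ _ _ _ v _ (nbhs z.2)) (cv _) => P.
exact: cvg_snd.
Qed.

Lemma continuous_momentum_flip : continuous (@momentum_flip R d).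
Proof.
move=> z.
apply: (@cvg_pair _ _ _ _ (nbhs z.1) (nbhs (- z.2)) _ _ _
  fst (fun w => - w.2)); first by move=> P; exact: cvg_fst.
by apply: cvgN => P; exact: cvg_snd.
Qed.

Lemma uniform_cvg_kick (G_ : nat -> 'rV[R]_d -> 'rV[R]_d) G (h : R) Cs :
  {uniform fst @` Cs, G_ @ \oo --> G} ->
  {uniform Cs, (fun N => kick (G_ N) h) @ \oo --> kick G h}.
Proof.
move=> /uniform_cvgP cG; apply/uniform_cvgP => e e0.
have h1 : 0 < `|h| + 1 by rewrite ltr_pwDr.
apply: filterS (cG (e / (`|h| + 1)) (divr_gt0 e0 h1)) => N GN z Cz.
have {GN} : ball (G z.1) (e / (`|h| + 1)) (G_ N z.1) by apply: GN; exists z.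
rewrite mx_norm_ball /ball_ /= ltr_pdivlMr// mulrDr mulr1 => Gz.
split => /=; first exact: ballxx.
rewrite mx_norm_ball /ball_ /= opprB addrC addrA subrK -scalerBr normrZ distrC.
rewrite mulrC; by apply: le_lt_trans Gz; rewrite lerDl.
Qed.

(** Each leapfrog step is a kick, a drift and a kick; admissibility keeps the
    input of every one of these stages in the common compact set [Cs], so the
    composition lemma applies to them in turn. *)
Lemma uniform_cvg_leapfrog_iter (G_ : nat -> 'rV[R]_d -> 'rV[R]_d) G v (h : R)
    (L : nat) (C Cs : set (phasePoint R d)) :
  compact Cs -> {within fst @` Cs, continuous G} -> continuous v ->
  {uniform fst @` Cs, G_ @ \oo --> G} ->
  (\forall N \near \oo, trajectory_in (G_ N) v h L C Cs) ->
  trajectory_in G v h L C Cs ->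
  forall l, (l <= L)%N ->
  {uniform C, (fun N => iter l (leapfrog (G_ N) v h)) @ \oo -->
    iter l (leapfrog G v h)}.
Proof.
move=> cCs cG cv uG tG_ [tG _].
have cdrift : {within Cs, continuous (drift v h)}.
  by apply: continuous_subspaceT; exact: continuous_drift.
have ckick := @within_continuous_kick G (h / 2) Cs cG.
have ukick := @uniform_cvg_kick G_ G (h / 2) Cs uG.
elim=> [_|l IH lL]; first exact: uniform_cvg_cst.
have [t1 t2 t3] := tG l lL; rewrite !image_comp in t2 t3.
have n1 : \forall N \near \oo, iter l (leapfrog (G_ N) v h) @` C `<=` Cs.
  by apply: filterS tG_ => N [/(_ l lL)[]].
have n2 : \forall N \near \oo,
    (kick (G_ N) (h / 2) \o iter l (leapfrog (G_ N) v h)) @` C `<=` Cs.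
  by apply: filterS tG_ => N [/(_ l lL)[_ + _ _]]; rewrite image_comp.
have n3 : \forall N \near \oo, (drift v h \o
    (kick (G_ N) (h / 2) \o iter l (leapfrog (G_ N) v h))) @` C `<=` Cs.
  by apply: filterS tG_ => N [/(_ l lL)[_ _ + _]]; rewrite image_comp.
have u1 := uniform_cvg_comp cCs ckick n1 t1 (IH (ltnW lL)) ukick.
have u2 := uniform_cvg_comp cCs cdrift n2 t2 u1 (@uniform_cvg_cst _ _ _ _ _).
exact: uniform_cvg_comp cCs ckick n3 t3 u2 ukick.
Qed.

Lemma uniform_cvg_proposal (G_ : nat -> 'rV[R]_d -> 'rV[R]_d) G v (h : R)
    (L : nat) (C Cs : set (phasePoint R d)) :
  compact Cs -> {within fst @` Cs, continuous G} -> continuous v ->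
  {uniform fst @` Cs, G_ @ \oo --> G} ->
  (\forall N \near \oo, trajectory_in (G_ N) v h L C Cs) ->
  trajectory_in G v h L C Cs ->
  {uniform C, (fun N => proposal (G_ N) v h L) @ \oo --> proposal G v h L}.
Proof.
move=> cCs cG cv uG tG_ tG; apply: (uniform_cvg_comp cCs _ _ tG.2).
- by apply: continuous_subspaceT; exact: continuous_momentum_flip.
- by apply: filterS tG_ => N [].
- exact: (uniform_cvg_leapfrog_iter cCs cG cv uG tG_ tG (leqnn L)).
- exact: uniform_cvg_cst.
Qed.

End ProposalConvergence.

(** The containment is listed as the stage l = 0 when L > 0, and as the final
    position when L = 0. *)
Lemma trajectory_in_sub {R : realType} {d : nat} (G v : 'rV[R]_d -> 'rV[R]_d)
    (h : R) (L : nat) (C Cs : set (phasePoint R d)) :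
  trajectory_in G v h L C Cs -> C `<=` Cs.
Proof.
case: L => [[_ CCs]|L [/(_ 0%N (ltn0Sn _))[CCs _ _] _]] z Cz;
  by apply: CCs; exists z.
Qed.

Lemma proposal_in {R : realType} {d : nat} (G v : 'rV[R]_d -> 'rV[R]_d)
    (h : R) (L : nat) (C Cs : set (phasePoint R d)) :
  @momentum_flip R d @` Cs = Cs -> trajectory_in G v h L C Cs ->
  proposal G v h L @` C `<=` Cs.
Proof.
move=> flipCs [_ CCs] _ [z Cz <-]; rewrite -flipCs.
by exists (iter L (leapfrog G v h) z) => //; apply: CCs; exists z.
Qed.

(** * Convergence of the acceptance probabilities *)

(** [min 1 (exp t) = exp (min 0 t)], and [exp] is 1-Lipschitz on the
    nonpositive half-line. *)
Lemma min1_expR_lipschitz {R : realType} (s t : R) :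
  `|Num.min 1 (expR s) - Num.min 1 (expR t)| <= `|s - t|.
Proof.
wlog st : s t / s <= t => [h|].
  by case: (leP s t) => [/h//|/ltW/h]; rewrite distrC (distrC t).
have minE u : Num.min 1 (expR u) = expR (Num.min 0 u).
  have [u0|u0] := leP 0 u; last by rewrite min_r// expR_le1 ltW.
  by rewrite expR0 min_l//; have := expR_ge1Dx u; lra.
have mts : 0 <= Num.min 0 t - Num.min 0 s <= t - s.
  by case: (leP 0 t); case: (leP 0 s); lra.
rewrite !minE; have : Num.min 0 t <= 0 by rewrite ge_min lexx.
move: (Num.min 0 s) (Num.min 0 t) mts => a b ab b0.
rewrite distrC ger0_norm ?subr_ge0 ?ler_expR; last by lra.
rewrite distrC ger0_norm ?subr_ge0//.
have -> : expR a = expR b * expR (a - b) by rewrite -expRD; congr expR; lra.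
have eb : expR b <= 1 by rewrite expR_le1.
have := expR_ge1Dx (a - b); have := expR_gt0 b; nra.
Qed.

Section Acceptance.
Context {R : realType} {d : nat}.
Implicit Types (K : 'rV[R]_d -> R) (z : phasePoint R d).

Lemma accept_lipschitz (U U' : 'rV[R]_d -> R) K
    (Psi Psi' : phasePoint R d -> phasePoint R d) z :
  `|accept U K Psi z - accept U' K Psi' z| <=
  `|hamiltonian U K (Psi z) - hamiltonian U' K (Psi' z)| +
  `|hamiltonian U K z - hamiltonian U' K z|.
Proof.
apply: (le_trans (min1_expR_lipschitz _ _)).
set a := hamiltonian U K (Psi z); set b := hamiltonian U K z.
set a' := hamiltonian U' K (Psi' z); set b' := hamiltonian U' K z.
have -> : - a + b - (- a' + b') = - (a - a') + (b - b') by lra.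
by rewrite (le_trans (ler_normD _ _))// normrN.
Qed.

Lemma weightE (U : 'rV[R]_d -> \bar R) K z : U z.1 \is a fin_num ->
  weight U K z = expR (- hamiltonian (fine \o U) K z).
Proof. by rewrite /weight /ehamiltonian /hamiltonian /=; case: (U z.1). Qed.

(** Where the extended potential is finite, the ratio of weights is the
    exponential of a difference of energies. *)
Lemma eaccept_fine (U : 'rV[R]_d -> \bar R) K
    (Psi : phasePoint R d -> phasePoint R d) z :
  U z.1 \is a fin_num -> U (Psi z).1 \is a fin_num ->
  eaccept U K Psi z = accept (fine \o U) K Psi z.
Proof.
move=> Uz UPz; rewrite /eaccept !weightE// expR_gt0 /accept.
by rewrite expRD expRN expRN invrK.
Qed.

(** A value within a finite distance of the real number U x is itself finite, so
    the value +oo disappears from a given compact set for large N. *)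
Lemma locally_uniform_ecvg_fine (X A : set 'rV[R]_d)
    (U_ : nat -> 'rV[R]_d -> \bar R) (U : 'rV[R]_d -> R) :
  locally_uniform_ecvg X U_ U -> compact A -> A `<=` X ->
  (\forall N \near \oo, forall x, A x -> U_ N x \is a fin_num) /\
  {uniform A, (fun N => fine \o U_ N) @ \oo --> U}.
Proof.
move=> cU cA AX; have {cU AX} /nnsup_cvg0P cU := cU A cA AX.
have fin (u : \bar R) (r e : R) : (`|u - r%:E| <= e%:E)%E -> u \is a fin_num.
  by case: u => //=; rewrite leNgt ltry.
split; first by apply: filterS (cU 1 ltr01) => N UN x /UN/fin.
apply/uniform_cvgP => e e0; have e20 : 0 < e / 2 by rewrite divr_gt0.
apply: filterS (cU _ e20) => N UN x Ax.
have := UN x Ax; have /fineK := fin _ _ _ (UN x Ax); rewrite /=.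
case: (U_ N x) => //= u _; rewrite lee_fin distrC => Uu.
rewrite -ball_normE /ball_ /=; lra.
Qed.

Lemma within_continuous_hamiltonian (U K : 'rV[R]_d -> R)
    (Cs : set (phasePoint R d)) :
  {within fst @` Cs, continuous U} -> continuous K ->
  {within Cs, continuous (hamiltonian U K)}.
Proof.
move=> /within_continuous_fst/subspace_continuousP cU cK.
apply/subspace_continuousP => z Cz; apply: cvgD; first exact: cU.
by apply: (@cvg_comp _ _ _ _ K _ (nbhs z.2)) (cK _); exact: cvg_within_snd.
Qed.

Lemma uniform_cvg_hamiltonian (U_ : nat -> 'rV[R]_d -> R) (U K : 'rV[R]_d -> R)
    (Cs : set (phasePoint R d)) :
  {uniform fst @` Cs, U_ @ \oo --> U} ->
  {uniform Cs, (fun N => hamiltonian (U_ N) K) @ \oo --> hamiltonian U K}.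
Proof.
move=> /uniform_cvgP cU; apply/uniform_cvgP => e /cU.
apply: filterS => N UN z Cz; have {UN} : ball (U z.1) e (U_ N z.1).
  by apply: UN; exists z.
by rewrite -ball_normE /ball_ /= /hamiltonian opprD addrACA subrr addr0.
Qed.

End Acceptance.

(** * Integrals of Lipschitz functions against the Metropolis kernel *)

Section PhaseSpace.
Context {R : realType} {d : nat}.
Implicit Types (X : set 'rV[R]_d) (z w : phasePoint R d)
  (f : phasePoint R d -> R).

(** Each of the 2d coordinates is at most the max-norm, hence the constant
    sqrt(2d). It translates Euclidean Lipschitz constants to the metric that
    carries the topology and the uniform convergence. *)
Lemma edist_le_norm z w : Defs.edist z w <= Num.sqrt (d + d)%:R * `|z - w|.
Proof.
have coord (x : 'rV[R]_d) i : `|x ord0 i| <= `|x|.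
  rewrite /Num.norm/= mx_normrE.
  exact: (le_bigmax _ (fun ij : 'I_1 * 'I_d => `|x ij.1 ij.2|) (ord0, i)).
have sumle (x y : 'rV[R]_d) : `|x - y| <= `|z - w| ->
    \sum_(i < d) (x ord0 i - y ord0 i) ^+ 2 <= d%:R * `|z - w| ^+ 2.
  move=> xn; rewrite mulr_natl -[X in _ *+ X]card_ord -sumr_const.
  apply: ler_sum => i _; rewrite -real_normK ?num_real//.
  rewrite ler_sqr ?nnegrE// (le_trans _ xn)//.
  by have := coord (x - y) i; rewrite !mxE.
rewrite -[X in _ * X]ger0_norm// -sqrtr_sqr -sqrtrM// ler_wsqrtr//.
by rewrite natrD mulrDl lerD// sumle// prod_normE le_max lexx ?orbT.
Qed.

(** The convention x / 0 = 0 in [lip] therefore concerns diagonal pairs only, and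
    no pair of distinct points escapes the Lipschitz bound. *)
Lemma edist0_eq z w : Defs.edist z w = 0 -> z = w.
Proof.
have sum_ge0 (x y : 'rV[R]_d) : 0 <= \sum_(i < d) (x ord0 i - y ord0 i) ^+ 2.
  by apply: sumr_ge0 => i _; exact: sqr_ge0.
have sum_eq0 (x y : 'rV[R]_d) :
    \sum_(i < d) (x ord0 i - y ord0 i) ^+ 2 == 0 -> x = y.
  rewrite psumr_eq0; last by move=> i _; exact: sqr_ge0.
  move=> /allP xy; apply/rowP => i; apply/eqP; rewrite -subr_eq0 -sqrf_eq0.
  by apply: xy; rewrite mem_index_enum.
move=> /eqP; rewrite sqrtr_eq0 => zw.
have {zw}: \sum_(i < d) (z.1 ord0 i - w.1 ord0 i) ^+ 2
    + \sum_(i < d) (z.2 ord0 i - w.2 ord0 i) ^+ 2 == 0.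
  by rewrite eq_le zw addr_ge0.
rewrite paddr_eq0// => /andP[/sum_eq0 zw1 /sum_eq0 zw2].
by case: z w zw1 zw2 => [? ?] [? ?] /= -> ->.
Qed.

Lemma open_orthant : open (@orthant R d).
Proof.
rewrite openE => x /= x0.
exists (fun _ _ => [set y | 0 < y]) => [i j|y y0 i]; last exact: y0.
by rewrite (ord1 i); apply: open_nbhs_nbhs; split; [exact: open_gt|exact: x0].
Qed.

Lemma open_phase X : position_space X -> open (phase X).
Proof.
move=> hX; have oX : open X.
  by case: hX => ->; [exact: openT | exact: open_orthant].
by apply: (open_comp _ oX) => z _ P; exact: cvg_fst.
Qed.

Lemma supnorm_bound X f z : (supnorm X f < +oo)%E -> X z.1 ->
  `|f z| <= fine (supnorm X f).
Proof.
move=> fX Xz; rewrite -lee_fin fineK; last by rewrite ge0_fin_numE// nnsup_ge0.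
exact: (nnsup_ub (A := phase X) (fun z => `|f z|%:E)).
Qed.

Lemma lip_bound X f z w : (lip X f < +oo)%E -> X z.1 -> X w.1 ->
  `|f z - f w| <= fine (lip X f) * (Num.sqrt (d + d)%:R * `|z - w|).
Proof.
move=> fX Xz Xw; have l0 : (0 <= lip X f)%E by exact: nnsup_ge0.
have [->|zw] := eqVneq z w; first by rewrite !subrr !normr0 !mulr0.
have e0 : 0 < Defs.edist z w.
  by rewrite lt0r sqrtr_ge0 andbT; apply: contra_neq zw; exact: edist0_eq.
apply: (@le_trans _ _ (fine (lip X f) * Defs.edist z w)); last first.
  by rewrite ler_wpM2l ?fine_ge0// edist_le_norm.
rewrite -ler_pdivrMr// -lee_fin fineK; last by rewrite ge0_fin_numE.
exact: (nnsup_ub (A := phase X `*` phase X)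
  (fun zw => (`|f zw.1 - f zw.2| / Defs.edist zw.1 zw.2)%:E) (t := (z, w))).
Qed.

Lemma measurable_phase X : position_space X ->
  measurable (phase X : set (borel (phasePoint R d))).
Proof. by move=> /open_phase oX; exact: sub_sigma_algebra. Qed.

(** A Lipschitz function is continuous on the open phase space, so the preimages
    of the open rays generating the Borel sets of the line are open. *)
Lemma lip_measurable X f : position_space X -> (lip X f < +oo)%E ->
  measurable_fun (phase X : set (borel (phasePoint R d)))
    (f : borel (phasePoint R d) -> R).
Proof.
move=> hX fX; have oX := open_phase hX.
apply: (measurability _ (RGenOInfty.measurableE R)).
move=> _ [_ [a ->] <-]; apply: sub_sigma_algebra.
apply: (iffLR (continuous_inP f oX)); last by rewrite set_itvE; exact: open_gt.
move=> z; rewrite inE => Xz; apply/cvgrPdist_lt => e e0.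
set l := fine (lip X f) * Num.sqrt (d + d)%:R.
have l1 : 0 < l + 1.
  by rewrite ltr_wpDl// mulr_ge0 ?sqrtr_ge0// fine_ge0// nnsup_ge0.
have nX : nbhs z (phase X) by exact: open_nbhs_nbhs.
near=> w; have Xw : phase X w by near: w.
apply: (le_lt_trans (lip_bound fX Xz Xw)); rewrite mulrA -/l.
apply: (@le_lt_trans _ _ ((l + 1) * `|z - w|)).
  by rewrite ler_wpM2r// lerDl.
rewrite mulrC -ltr_pdivlMr//; near: w.
by apply: cvgr_dist_lt; rewrite ?divr_gt0.
Unshelve. all: by end_near. Qed.

End PhaseSpace.

Section WeightedDirac.
Context {disp : measure_display} {T : measurableType disp} {R : realType}.
Variables (D : set T) (mD : measurable D) (f : T -> R).
Variables (mf : measurable_fun D f) (k : {nonneg R}) (a : T) (Da : D a).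

Let mEf : measurable_fun D (EFin \o f).
Proof. exact/measurable_EFinP. Qed.

Let ge0_integral (g : T -> \bar R) : measurable_fun D g ->
  (forall x, D x -> 0 <= g x)%E ->
  (\int[mscale k (dirac a)]_(x in D) g x = k%:num%:E * g a)%E.
Proof.
move=> mg g0; rewrite ge0_integral_mscale// integral_dirac//.
by rewrite diracE mem_set// mul1e.
Qed.

Lemma integrable_mscale_dirac : (mscale k (dirac a)).-integrable D (EFin \o f).
Proof.
apply/integrableP; split=> //; rewrite ge0_integral ?ltry//.
exact: measurableT_comp.
Qed.

Lemma integral_mscale_dirac :
  (\int[mscale k (dirac a)]_(x in D) (f x)%:E = (k%:num * f a)%:E)%E.
Proof.
have mp := measurable_funepos mEf; have mn := measurable_funeneg mEf.
rewrite integralE !ge0_integral//= EFinM -[(f a)%:E]/((EFin \o f) a).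
by rewrite [in RHS](funeposneg (EFin \o f)) muleBr ?add_def_funeposneg.
Qed.

End WeightedDirac.

Section MetropolisIntegral.
Context {R : realType} {d : nat}.
Implicit Types (X : set 'rV[R]_d) (f : phasePoint R d -> R)
  (z : phasePoint R d) (Psi : phasePoint R d -> phasePoint R d).

Lemma phase_int_metropolis X (alpha : phasePoint R d -> R)
    (alpha01 : forall z, 0 <= alpha z <= 1) Psi f z :
  position_space X -> (lip X f < +oo)%E -> X z.1 -> X (Psi z).1 ->
  phase_int X (metropolis alpha01 Psi z) f =
    (alpha z * f (Psi z) + (1 - alpha z) * f z)%:E.
Proof.
move=> hX fX Xz XPz; have mX := measurable_phase hX.
have mf := lip_measurable hX fX.
rewrite /phase_int /metropolis integral_measure_add//.
- by rewrite !integral_mscale_dirac.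
- exact: integrable_mscale_dirac.
- exact: integrable_mscale_dirac.
Qed.

(** Splitting the difference of the two-point averages as
    (a' - a) (f (Psi' z) - f z) + a (f (Psi' z) - f (Psi z)): a change of
    acceptance probability costs the oscillation of [f], a displacement of the
    proposal costs the Lipschitz constant. *)
Lemma phase_int_metropolis_dist X (alpha alpha' : phasePoint R d -> R)
    (alpha01 : forall z, 0 <= alpha z <= 1)
    (alpha'01 : forall z, 0 <= alpha' z <= 1) Psi Psi' f z :
  position_space X -> (supnorm X f < +oo)%E -> (lip X f < +oo)%E ->
  X z.1 -> X (Psi z).1 -> X (Psi' z).1 ->
  (`|phase_int X (metropolis alpha'01 Psi' z) f -
     phase_int X (metropolis alpha01 Psi z) f| <=
   (2 * fine (supnorm X f) * `|alpha' z - alpha z| +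
    fine (lip X f) * (Num.sqrt (d + d)%:R * `|Psi' z - Psi z|))%:E)%E.
Proof.
move=> hX sX lX Xz XPz XP'z.
rewrite !phase_int_metropolis// -EFinB lee_fin.
have -> : alpha' z * f (Psi' z) + (1 - alpha' z) * f z -
    (alpha z * f (Psi z) + (1 - alpha z) * f z) =
    (alpha' z - alpha z) * (f (Psi' z) - f z) +
    alpha z * (f (Psi' z) - f (Psi z)) by ring.
apply: (le_trans (ler_normD _ _)); rewrite !normrM lerD//.
  rewrite mulrC ler_wpM2r// (le_trans (ler_normB _ _))//.
  by rewrite mulr_natl mulr2n lerD// supnorm_bound.
have /andP[a0 a1] := alpha01 z.
rewrite ger0_norm//; apply: le_trans (lip_bound lX XP'z XPz).
by rewrite ler_piMl.
Qed.

End MetropolisIntegral.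

(** * Convergence of the Metropolis kernels *)

Theorem theorem3p4 (R : realType) (d : nat)
  (X : set 'rV[R]_d) (hX : position_space X)
  (G_ : nat -> 'rV[R]_d -> 'rV[R]_d) (G v : 'rV[R]_d -> 'rV[R]_d)
  (mG : forall N, measurable_field X (G_ N))
  (cvgG : locally_uniform_cvg X G_ G)
  (contG : {within X, continuous G})
  (contv : continuous v)
  (h : R) (h0 : 0 < h) (L : nat)
  (U_ : nat -> 'rV[R]_d -> \bar R) (U K : 'rV[R]_d -> R)
  (mU : forall N, measurable_potential X (U_ N))
  (U_gtNy : forall N x, X x -> (-oo < U_ N x)%E)
  (cvgU : locally_uniform_ecvg X U_ U)
  (contU : {within X, continuous U})
  (contK : continuous K)
  (C : set ('rV[R]_d * 'rV[R]_d)) (hC : admissible X G_ G v h L C) :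
  let Psi_ N := proposal (G_ N) v h L in
  let Psi := proposal G v h L in
  let alpha_ N := eaccept (U_ N) K (Psi_ N) in
  let alpha := accept U K Psi in
  let M_ N := emetropolis_kernel (U_ N) K (Psi_ N) in
  let M := metropolis_kernel U K Psi in
  [/\ (fun N => nnsup C (fun z => `|alpha_ N z - alpha z|%:E)) @ \oo --> 0%E,
      forall f : 'rV[R]_d * 'rV[R]_d -> R,
        (supnorm X f < +oo)%E -> (lip X f < +oo)%E ->
        (fun N => nnsup C (fun z => `|phase_int X (M_ N z) f - phase_int X (M z) f|%E))
          @ \oo --> 0%E &
      (fun N => nnsup C (fun z => dBL X (M_ N z) (M z))) @ \oo --> 0%E].
Proof.
move=> Psi_ Psi alpha_ alpha M_ M.
case: hC => _ CX [Cs [N0 [cCs tr flipCs [_ clX]]]].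
have CsX z : Cs z -> X z.1 by move=> Cz; apply/clX/subset_closure; exists z.
have AX : fst @` Cs `<=` X by move=> _ [z Cz <-]; exact: CsX.
have cA : compact (fst @` Cs).
  apply: continuous_compact cCs; apply: continuous_subspaceT => z P.
  exact: cvg_fst.
have cG := continuous_subspaceW AX contG.
have tG : trajectory_in G v h L C Cs by have [] := tr N0 (leqnn _).
have tG_ : \forall N \near \oo, trajectory_in (G_ N) v h L C Cs.
  by exists N0 => // N /= /tr[].
have CCs := trajectory_in_sub tG.
have PsiCs : Psi @` C `<=` Cs by exact: proposal_in.
have Psi_Cs : \forall N \near \oo, Psi_ N @` C `<=` Cs.
  by apply: filterS tG_ => N; exact: proposal_in.
have uPsi : {uniform C, Psi_ @ \oo --> Psi}.
  exact: (uniform_cvg_proposal cCs cG contv (cvgG _ cA AX) tG_ tG).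
have [finU uU] := locally_uniform_ecvg_fine cvgU cA AX.
have uH := uniform_cvg_hamiltonian (K := K) uU.
have cH := within_continuous_hamiltonian (continuous_subspaceW AX contU) contK.
have /uniform_cvgP uHPsi := uniform_cvg_comp cCs cH Psi_Cs PsiCs uPsi uH.
move: uPsi uH => /uniform_cvgP uPsi /uniform_cvgP uH.
have ualpha e : 0 < e ->
    \forall N \near \oo, forall z, C z -> `|alpha_ N z - alpha z| <= e.
  move=> e0; have e20 : 0 < e / 2 by rewrite divr_gt0.
  near=> N => z Cz.
  have Csz := CCs z Cz.
  have CsPz : Cs (Psi_ N z) by apply: (near Psi_Cs N) => //; exists z.
  have fin w : Cs w -> U_ N w.1 \is a fin_num.
    by move=> Cw; apply: (near finU N) => //; exists w.
  rewrite /alpha_ eaccept_fine; [|exact: fin|exact: fin].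
  apply: (le_trans (accept_lipschitz _ _ _ _ _ _)).
  have hz : ball (hamiltonian U K z) (e / 2) (hamiltonian (fine \o U_ N) K z).
    by move: z Csz {Cz CsPz}; near: N; exact: uH.
  have hPz : ball (hamiltonian U K (Psi z)) (e / 2)
      (hamiltonian (fine \o U_ N) K (Psi_ N z)).
    by move: z Cz {hz Csz CsPz}; near: N; exact: uHPsi.
  move: hz hPz; rewrite -!ball_normE /ball_ /= => /ltW hz /ltW hPz.
  by rewrite [e]splitr lerD// distrC.
(* The threshold for [N] depends on [f] only through bounds on its two
   seminorms: this uniformity in [f] is what the distance [dBL] needs. *)
have uM B l e : 0 <= B -> 0 <= l -> 0 < e ->
    \forall N \near \oo, forall z, C z -> forall f,
      (supnorm X f <= B%:E)%E -> (lip X f <= l%:E)%E ->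
      (`|phase_int X (M_ N z) f - phase_int X (M z) f| <= e%:E)%E.
  move=> B0 l0 e0; set s : R := Num.sqrt (d + d)%:R.
  have s0 : 0 <= s by exact: sqrtr_ge0.
  have ls0 : 0 <= l * s by exact: mulr_ge0.
  have D0 : 0 < 2 * B + l * s + 1 by lra.
  (* Acceptance errors have the factor 2 B and displacements the factor l s; the
     summand 1 keeps the denominator positive. *)
  set r := e / (2 * B + l * s + 1).
  have r0 : 0 < r by rewrite divr_gt0.
  near=> N => z Cz f sB ll.
  have sX : (supnorm X f < +oo)%E by exact: le_lt_trans sB (ltry _).
  have lX : (lip X f < +oo)%E by exact: le_lt_trans ll (ltry _).
  have Psi_z : Cs (Psi_ N z) by apply: (near Psi_Cs N) => //; exists z.
  have Psiz : Cs (Psi z) by apply: PsiCs; exists z.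
  apply: (le_trans (phase_int_metropolis_dist _ _ hX sX lX _ _ _));
    [exact: CX|exact: CsX|exact: CsX|].
  have az : `|alpha_ N z - alpha z| <= r.
    by move: z Cz {Psi_z Psiz}; near: N; exact: ualpha.
  have : ball (Psi z) r (Psi_ N z).
    by move: z Cz {Psi_z Psiz az}; near: N; exact: uPsi.
  rewrite -ball_normE /ball_ /= distrC => /ltW pz.
  have {}sB : fine (supnorm X f) <= B.
    by rewrite -lee_fin fineK// ge0_fin_numE// nnsup_ge0.
  have {}ll : fine (lip X f) <= l.
    by rewrite -lee_fin fineK// ge0_fin_numE// nnsup_ge0.
  have -> : e = (2 * B + l * s + 1) * r by rewrite mulrC divfK// gt_eqF.
  rewrite lee_fin (@le_trans _ _ (2 * B * r + l * (s * r)))//; last by lra.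
  rewrite lerD// ler_pM ?mulr_ge0 ?fine_ge0 ?nnsup_ge0 ?ler_wpM2l//.
split.
- apply/nnsup_cvg0P => e /ualpha; apply: filterS => N aN z Cz.
  by rewrite lee_fin aN.
- move=> f sX lX; apply/nnsup_cvg0P => e e0.
  have [s0 l0] : (0 <= supnorm X f)%E /\ (0 <= lip X f)%E.
    by split; exact: nnsup_ge0.
  apply: filterS (uM _ _ e (fine_ge0 s0) (fine_ge0 l0) e0) => N MN z Cz.
  by apply: MN => //; rewrite fineK// ge0_fin_numE.
- apply/nnsup_cvg0P => e e0.
  apply: filterS (uM 1 1 e ler01 ler01 e0) => N MN z Cz.
  apply: ge_ereal_sup => _ [f /= f1 <-]; apply: MN => //.
    by apply: le_trans f1; rewrite leeDl// nnsup_ge0.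
  by apply: le_trans f1; rewrite leeDr// nnsup_ge0.
Unshelve. all: by end_near. Qed.
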